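(* Let $\Lambda$ be a row-finite $k$-graph without sources. Then $\Lambda$ is cofinal if and only if the talented monoid $T_\Lambda$ is a simple $\mathbb{Z}^k$-monoid.
   Context: **$k$-graphs.** $\mathbb{N}=\{0,1,2,\dots\}$, $k\ge 1$, $e_i$ is the $i$-th standard generator of $\mathbb{N}^k$; $\mathbb{N}^k$ is ordered coordinatewise. A $k$-graph is a countable small category $\Lambda$ with nonempty object set $\Lambda^0$ (identified with the identity morphisms), range and source maps $r,s:\Lambda\to\Lambda^0$, and a functor $d:\Lambda\to\mathbb{N}^k$ with the unique factorization property: if $d(\lambda)=m+n$ there are unique $\mu_1,\mu_2\in\Lambda$ with $\lambda=\mu_1\mu_2$, $d(\mu_1)=m$, $d(\mu_2)=n$ (the product $\mu_1\mu_2$ is defined iff $s(\mu_1)=r(\mu_2)$). For $v,w\in\Lambda^0$, $n\in\mathbb{N}^k$: $v\Lambda^n=\{\lambda: r(\lambda)=v, d(\lambda)=n\}$ and $v\Lambda w=\{\lambda: r(\lambda)=v, s(\lambda)=w\}$. $\Lambda$ is row-finite if every $v\Lambda^n$ is finite, and has no sources if every $v\Lambda^n$ is nonempty. **Cofinality.** Let $\Omega_k=\{(m,n)\in\mathbb{N}^k\times\mathbb{N}^k: m\le n\}$ be the $k$-graph with $r(m,n)=m$, $s(m,n)=n$, $(m,n)(n,p)=(m,p)$, $d(m,n)=n-m$. $\Lambda^\infty$ is the set of degree-preserving functors $x:\Omega_k\to\Lambda$ (infinite paths); $x(m):=x(m,m)\in\Lambda^0$. $\Lambda$ is cofinal if for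 every $x\in\Lambda^\infty$ and $v\in\Lambda^0$ there is $n\in\mathbb{N}^k$ with $v\Lambda x(n)\ne\emptyset$. **Talented monoid.** $T_\Lambda$ is the commutative monoid generated by symbols $v(n)$ ($v\in\Lambda^0$, $n\in\mathbb{Z}^k$) subject to $v(n)=\sum_{\alpha\in v\Lambda^{e_i}}s(\alpha)(n+e_i)$ for all $v$, $n$ and $i\in\{1,\dots,k\}$ with $v\Lambda^{e_i}\neq\emptyset$. $\mathbb{Z}^k$ acts on $T_\Lambda$ by monoid automorphisms determined by ${}^{n}v(m)=v(m+n)$. **Simplicity.** In a commutative monoid put $x\le y$ iff $y=x+z$ for some $z$. A $\mathbb{Z}^k$-order ideal of a $\mathbb{Z}^k$-monoid is a submonoid $J$ closed under the action such that $x\le y\in J$ implies $x\in J$. A nonzero conical $\mathbb{Z}^k$-monoid $M$ (conical: $x+y=0$ implies $x=y=0$) is simple if $\{0\}$ and $M$ are its only $\mathbb{Z}^k$-order ideals. *)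

(* Defs.v *)
From HB Require Import structures.
From mathcomp Require Import all_boot all_order all_algebra.
From mathcomp Require Import finmap multiset.
From mathcomp Require Import boolp classical_sets cardinality fsbigop.

Set Implicit Arguments.
Unset Strict Implicit.
Unset Printing Implicit Defensive.

Import GRing.Theory.
Local Open Scope fmap_scope.
Local Open Scope mset_scope.
Local Open Scope classical_set_scope.
Local Open Scope ring_scope.
Local Open Scope quotient_scope.

Notation "''N^' k" := {ffun 'I_k -> nat}
  (at level 8, k at level 2, format "''N^' k") : type_scope.
Notation "''Z^' k" := {ffun 'I_k -> int}
  (at level 8, k at level 2, format "''Z^' k") : type_scope.

Definition egen k (i : 'I_k) : 'N^k := [ffun j => (j == i) : nat].

Definition zvec k (m : 'N^k) : 'Z^k := [ffun j => (m j)%:Z].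

Definition lev k (m n : 'N^k) : bool := [forall i, (m i <= n i)%N].

(* Objects and identity morphisms are kept apart; [idm] is the identification
   of the former with the latter.
   Composition is a total function whose values on non-composable pairs are
   irrelevant: every axiom about [comp] assumes [src a = rng b]. *)
Record kgraph (k : nat) := KGraph {
  obj : countType;
  mor : countType;
  obj_inh : inhabited obj;
  rng : mor -> obj;
  src : mor -> obj;
  idm : obj -> mor;
  comp : mor -> mor -> mor;
  deg : mor -> 'N^k;
  rng_id : forall v, rng (idm v) = v;
  src_id : forall v, src (idm v) = v;
  rng_comp : forall a b, src a = rng b -> rng (comp a b) = rng a;
  src_comp : forall a b, src a = rng b -> src (comp a b) = src b;
  comp_idl : forall a, comp (idm (rng a)) a = a;
  comp_idr : forall a, comp a (idm (src a)) = a;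
  compA : forall a b c, src a = rng b -> src b = rng c ->
    comp a (comp b c) = comp (comp a b) c;
  deg_id : forall v, deg (idm v) = 0;
  deg_comp : forall a b, src a = rng b -> deg (comp a b) = deg a + deg b;
  unique_factorization : forall l m n, deg l = m + n ->
    exists! p : mor * mor,
      [/\ src p.1 = rng p.2, l = comp p.1 p.2, deg p.1 = m & deg p.2 = n]
}.

Section KGraphs.
Variable k : nat.
Implicit Types L : kgraph k.

Definition paths_from L (v : obj L) (n : 'N^k) : set (mor L) :=
  [set a | rng a = v /\ deg a = n].

Definition paths_between L (v w : obj L) : set (mor L) :=
  [set a | rng a = v /\ src a = w].

Definition row_finite L :=
  forall (v : obj L) (n : 'N^k), finite_set (paths_from v n).

Definition no_sources L :=
  forall (v : obj L) (n : 'N^k), paths_from v n !=set0.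

Record kfunctor L L' := KFunctor {
  fobj : obj L -> obj L';
  fmor : mor L -> mor L';
  fmor_rng : forall a, rng (fmor a) = fobj (rng a);
  fmor_src : forall a, src (fmor a) = fobj (src a);
  fmor_id : forall v, fmor (idm v) = idm (fobj v);
  fmor_comp : forall a b, src a = rng b ->
    fmor (comp a b) = comp (fmor a) (fmor b);
  fmor_deg : forall a, deg (fmor a) = deg a
}.

Definition omega_mor := {p : 'N^k * 'N^k | lev p.1 p.2}.

Definition omega_rng (p : omega_mor) : 'N^k := (val p).1.
Definition omega_src (p : omega_mor) : 'N^k := (val p).2.

Lemma lev_refl (m : 'N^k) : lev m m.
Proof. exact/forallP. Qed.

Lemma lev_trans (n m p : 'N^k) : lev m n -> lev n p -> lev m p.
Proof.
move=> /forallP mn /forallP np; apply/forallP => i.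
exact: leq_trans (mn i) (np i).
Qed.

Definition omega_id (m : 'N^k) : omega_mor :=
  exist (fun p : 'N^k * 'N^k => lev p.1 p.2) (m, m) (lev_refl m).

(* The default [a] of [insubd] is only returned on non-composable pairs. *)
Definition omega_comp (a b : omega_mor) : omega_mor :=
  insubd a ((val a).1, (val b).2).

Definition omega_deg (a : omega_mor) : 'N^k :=
  [ffun i => ((val a).2 i - (val a).1 i)%N].

Lemma val_omega_comp a b : omega_src a = omega_rng b ->
  val (omega_comp a b) = ((val a).1, (val b).2).
Proof.
move=> ab; rewrite val_insubd ifT//=.
by apply: lev_trans (valP a) _; rewrite [(val a).2]ab; exact: (valP b).
Qed.

Lemma omega_inh : inhabited 'N^k.
Proof. exact: (inhabits 0). Qed.

Lemma omega_rng_comp a b : omega_src a = omega_rng b ->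
  omega_rng (omega_comp a b) = omega_rng a.
Proof. by move=> /val_omega_comp; rewrite {1}/omega_rng => ->. Qed.

Lemma omega_src_comp a b : omega_src a = omega_rng b ->
  omega_src (omega_comp a b) = omega_src b.
Proof. by move=> /val_omega_comp; rewrite {1}/omega_src => ->. Qed.

Lemma omega_comp_idl a : omega_comp (omega_id (omega_rng a)) a = a.
Proof.
by apply: val_inj; rewrite val_omega_comp//=; case: a => -[].
Qed.

Lemma omega_comp_idr a : omega_comp a (omega_id (omega_src a)) = a.
Proof.
by apply: val_inj; rewrite val_omega_comp//=; case: a => -[].
Qed.

Lemma omega_compA a b c :
  omega_src a = omega_rng b -> omega_src b = omega_rng c ->
  omega_comp a (omega_comp b c) = omega_comp (omega_comp a b) c.
Proof.
move=> ab bc; apply: val_inj.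
by rewrite !val_omega_comp// ?omega_rng_comp ?omega_src_comp.
Qed.

Lemma omega_deg_id v : omega_deg (omega_id v) = 0.
Proof. by apply/ffunP => i; rewrite !ffunE /= subnn. Qed.

Lemma omega_deg_comp a b : omega_src a = omega_rng b ->
  omega_deg (omega_comp a b) = omega_deg a + omega_deg b.
Proof.
move=> ab; apply/ffunP => i; rewrite !ffunE val_omega_comp//=.
have /forallP/(_ i) a12 := valP a; have /forallP/(_ i) b12 := valP b.
have abi : (val a).2 i = (val b).1 i by rewrite [(val a).2]ab.
by rewrite natrDE addnC -abi addnBA// subnK// abi.
Qed.

Lemma omega_factorization l m n : omega_deg l = m + n ->
  exists! p : omega_mor * omega_mor,
    [/\ omega_src p.1 = omega_rng p.2, l = omega_comp p.1 p.2,
        omega_deg p.1 = m & omega_deg p.2 = n].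
Proof.
move=> dl.
pose q : 'N^k := (val l).1 + m.
have ll i : ((val l).1 i <= (val l).2 i)%N by have /forallP := valP l; apply.
have di i : ((val l).2 i - (val l).1 i = m i + n i)%N.
  by move/ffunP/(_ i): dl; rewrite !ffunE.
have h1 : lev (val l).1 q.
  by apply/forallP => i; rewrite ffunE natrDE leq_addr.
have h2 : lev q (val l).2.
  apply/forallP => i; rewrite ffunE natrDE -(subnKC (ll i)) di.
  by rewrite addnA leq_addr.
exists (exist (fun p : 'N^k * 'N^k => lev p.1 p.2) ((val l).1, q) h1,
        exist (fun p : 'N^k * 'N^k => lev p.1 p.2) (q, (val l).2) h2).
split.
  split => //=.
  - by apply: val_inj; rewrite val_omega_comp//=; case: (val l).
  - by apply/ffunP => i; rewrite !ffunE /= natrDE addKn.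
  - apply/ffunP => i; rewrite !ffunE /= natrDE.
    by rewrite subnDA di addKn.
move=> [a b] /= [ab lab da _].
have vl : val l = ((val a).1, (val b).2) by rewrite lab val_omega_comp.
have qa : q = (val a).2.
  apply/ffunP => i; rewrite ffunE vl /= -da ffunE natrDE subnKC//.
  by have /forallP := valP a; apply.
congr (_, _); apply: val_inj => /=.
  by rewrite vl qa /=; case: (a) => -[].
by rewrite vl qa [(val a).2]ab /=; case: (b) => -[].
Qed.

Definition Omega : kgraph k :=
  @KGraph k 'N^k omega_mor omega_inh omega_rng omega_src omega_id omega_comp
    omega_deg (fun=> erefl) (fun=> erefl) omega_rng_comp omega_src_comp
    omega_comp_idl omega_comp_idr omega_compA omega_deg_id omega_deg_comp
    omega_factorization.

Definition infinite_path L := kfunctor Omega L.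

Definition cofinal L :=
  forall (x : infinite_path L) (v : obj L),
    exists n : 'N^k, paths_between v (fobj x n) !=set0.

End KGraphs.

Section MsetNmodule.
Variable K : choiceType.

HB.instance Definition _ :=
  Choice.copy {mset K} {fsfun K -> nat with 0%N}.

Lemma mset_addA : associative (@msetD K).
Proof. by move=> A B C; apply/msetP => a; rewrite !msetE2 addnA. Qed.

Lemma mset_addC : commutative (@msetD K).
Proof. exact: msetDC. Qed.

Lemma mset_add0 : left_id (@mset0 K) (@msetD K).
Proof. by move=> A; apply/msetP => a; rewrite !msetE2 mset0E. Qed.

HB.instance Definition _ :=
  GRing.isNmodule.Build {mset K} mset_addA mset_addC mset_add0.

End MsetNmodule.

(* Commutative monoids with an action of G by monoid automorphisms ([gact g] is
   invertible, with inverse [gact (- g)], by [gact0] and [gactD]). *)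
Record gmonoid (G : zmodType) := GMonoid {
  gcarrier :> nmodType;
  gact : G -> gcarrier -> gcarrier;
  gact0 : forall x, gact 0 x = x;
  gactD : forall g h x, gact (g + h) x = gact g (gact h x);
  gact_zero : forall g, gact g 0 = 0;
  gact_add : forall g x y, gact g (x + y) = gact g x + gact g y
}.

Section Simplicity.
Variables (G : zmodType).
Implicit Types M : gmonoid G.

Definition mle M (x y : M) := exists z : M, y = x + z.

Record order_ideal M (J : set M) : Prop := OrderIdeal {
  ideal_zero : J 0;
  ideal_add : forall x y, J x -> J y -> J (x + y);
  ideal_act : forall g x, J x -> J (gact g x);
  ideal_le : forall x y, mle x y -> J y -> J x
}.

Definition conical M := forall x y : M, x + y = 0 -> x = 0 /\ y = 0.

Definition simple_gmonoid M :=
  [/\ exists x : M, x != 0,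
      conical M
    & forall J : set M, order_ideal J -> J = [set 0] \/ J = setT].

End Simplicity.

(* The congruence on the free commutative monoid {mset Lambda^0 * Z^k} whose
   quotient is the talented monoid.  The sum over [paths_from v (egen i)] is
   the intended one as soon as this set is finite ([fsbigop] otherwise returns
   the empty sum), hence for every row-finite k-graph. *)
Section TalentedMonoid.
Variables (k : nat) (L : kgraph k).

Definition tgen : choiceType := (obj L * 'Z^k)%type.

Inductive tcongr : {mset tgen} -> {mset tgen} -> Prop :=
| tcongr_gen (v : obj L) (n : 'Z^k) (i : 'I_k) :
    paths_from v (egen i) !=set0 ->
    tcongr [mset (v, n)]
      (\sum_(a \in paths_from v (egen i)) [mset (src a, n + zvec (egen i))])
| tcongr_refl x : tcongr x x
| tcongr_sym x y : tcongr x y -> tcongr y x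
| tcongr_trans y x z : tcongr x y -> tcongr y z -> tcongr x z
| tcongr_add x y z : tcongr x y -> tcongr (x + z) (y + z).

Definition tcongrb : rel {mset tgen} := fun x y => `[< tcongr x y >].

Lemma tcongrb_refl : reflexive tcongrb.
Proof. by move=> x; apply/asboolP; exact: tcongr_refl. Qed.

Lemma tcongrb_sym : symmetric tcongrb.
Proof.
by move=> x y; apply/asboolP/asboolP; exact: tcongr_sym.
Qed.

Lemma tcongrb_trans : transitive tcongrb.
Proof.
by move=> y x z /asboolP xy /asboolP yz; apply/asboolP; exact: tcongr_trans yz.
Qed.

Canonical tcongr_equiv :=
  EquivRel tcongrb tcongrb_refl tcongrb_sym tcongrb_trans.

Definition talented := {eq_quot tcongrb}.

HB.instance Definition _ := Choice.on talented.
HB.instance Definition _ := EqQuotient.on talented.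

Lemma talented_piP (x y : {mset tgen}) :
  (\pi_talented x = \pi_talented y) <-> tcongr x y.
Proof.
by split=> [/eqmodP/asboolP //|xy]; apply/eqmodP/asboolP.
Qed.

Definition talented_add (x y : talented) : talented :=
  \pi_talented (repr x + repr y).

Lemma tcongr_reprl (x : {mset tgen}) : tcongr (repr (\pi_talented x)) x.
Proof. by apply/talented_piP; rewrite reprK. Qed.

Lemma tcongr_add2 x x' y y' :
  tcongr x x' -> tcongr y y' -> tcongr (x + y) (x' + y').
Proof.
move=> xx' yy'; apply: (@tcongr_trans (x' + y)); first exact: tcongr_add.
by rewrite ![x' + _]addrC; exact: tcongr_add.
Qed.

Lemma talented_add_pi (x y : {mset tgen}) :
  talented_add (\pi_talented x) (\pi_talented y) = \pi_talented (x + y).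
Proof.
by apply/talented_piP; apply: tcongr_add2; exact: tcongr_reprl.
Qed.

Lemma talented_addA : associative talented_add.
Proof.
elim/quotW=> x; elim/quotW=> y; elim/quotW=> z.
by rewrite (talented_add_pi y) (talented_add_pi x) (talented_add_pi x)
  (talented_add_pi (x + y)) addrA.
Qed.

Lemma talented_addC : commutative talented_add.
Proof.
by elim/quotW=> x; elim/quotW=> y; rewrite !(talented_add_pi, addrC x).
Qed.

Lemma talented_add0 : left_id (\pi_talented 0) talented_add.
Proof. by move=> x; rewrite -[x]reprK talented_add_pi add0r. Qed.

HB.instance Definition _ :=
  GRing.isNmodule.Build talented talented_addA talented_addC talented_add0.

Definition tvertex (v : obj L) (n : 'Z^k) : talented :=
  \pi_talented [mset (v, n)].

Definition mshift (n : 'Z^k) (x : {mset tgen}) : {mset tgen} :=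
  \sum_(g <- x) [mset (g.1, g.2 + n)].

Lemma mshift0 n : mshift n 0 = 0.
Proof. by rewrite /mshift big_mset0. Qed.

Lemma mshiftD n x y : mshift n (x + y) = mshift n x + mshift n y.
Proof.
rewrite /mshift -big_cat; apply: perm_big; apply/allP => a _ /=.
by rewrite count_cat !count_mem_mset msetE2.
Qed.

Lemma mshift1 n g : mshift n [mset g] = [mset (g.1, g.2 + n)].
Proof. by rewrite /mshift big_msetn. Qed.

Lemma mshift_sum n (I : Type) (r : seq I) (F : I -> {mset tgen}) :
  mshift n (\sum_(i <- r) F i) = \sum_(i <- r) mshift n (F i).
Proof. exact: (big_morph _ (mshiftD n) (mshift0 n)). Qed.

Lemma mshift_id x : mshift 0 x = x.
Proof.
apply/msetP => a; rewrite -[in RHS](seq_mset_id x) mset_seqE -sum1_count.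
rewrite /mshift (big_morph (fun A : {mset tgen} => A a)
  (fun A B => (msetE2 A B a).1.1.1) (mset0E a)).
rewrite [RHS]big_mkcond /=; apply: eq_bigr => -[v m] _.
by rewrite msetnE /= addr0 eq_sym.
Qed.

Lemma mshift_comp m n x : mshift (m + n) x = mshift m (mshift n x).
Proof.
rewrite [mshift n x]/mshift mshift_sum; apply: eq_bigr => g _.
by rewrite mshift1 /= -addrA [n + m]addrC.
Qed.

Lemma mset1_neq0 (g : tgen) : [mset g] <> 0.
Proof. by move=> /msetP/(_ g); rewrite msetnxx mset0E. Qed.

Lemma finite_support_mset1 (A : set (mor L)) (F : mor L -> tgen) :
  finite_support 0 A (fun a => [mset F a]) = fset_set A :> seq (mor L).
Proof.
rewrite /finite_support unlock; congr (enum_fset (fset_set _)).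
apply/seteqP; split => a /=; first by case.
by move=> Aa; split => //; exact: mset1_neq0.
Qed.

Lemma tcongr_mshift n x y : tcongr x y -> tcongr (mshift n x) (mshift n y).
Proof.
elim=> {x y} [v m i vi|x|x y _|y x z _ + _|x y z _].
- rewrite mshift1 /= finite_support_mset1 mshift_sum.
  under eq_bigr do rewrite mshift1 /= addrC addrA.
  rewrite -(finite_support_mset1 _ (fun a => (src a, n + m + zvec (egen i)))).
  rewrite [m + n]addrC; exact: tcongr_gen.
- exact: tcongr_refl.
- exact: tcongr_sym.
- exact: tcongr_trans.
- by rewrite !mshiftD; exact: tcongr_add.
Qed.

Definition talented_act (n : 'Z^k) (x : talented) : talented :=
  \pi_talented (mshift n (repr x)).

Lemma talented_act_pi n x :
  talented_act n (\pi_talented x) = \pi_talented (mshift n x).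
Proof. by apply/talented_piP; apply: tcongr_mshift; exact: tcongr_reprl. Qed.

Lemma talented_act0 x : talented_act 0 x = x.
Proof. by elim/quotW: x => x; rewrite talented_act_pi mshift_id. Qed.

Lemma talented_actD m n x :
  talented_act (m + n) x = talented_act m (talented_act n x).
Proof.
elim/quotW: x => x.
by rewrite (talented_act_pi n) !talented_act_pi mshift_comp.
Qed.

Lemma talented_act_zero n : talented_act n 0 = 0.
Proof. by rewrite [LHS](talented_act_pi n 0) mshift0. Qed.

Lemma talented_act_add n x y :
  talented_act n (x + y) = talented_act n x + talented_act n y.
Proof.
elim/quotW: x => x; elim/quotW: y => y.
have -> : \pi_talented x + \pi_talented y = \pi_talented (x + y).
  exact: talented_add_pi.
rewrite !(talented_act_pi n) mshiftD; exact/esym/talented_add_pi.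
Qed.

Definition talented_monoid : gmonoid 'Z^k :=
  GMonoid talented_act0 talented_actD talented_act_zero talented_act_add.

Lemma talented_act_tvertex n v m :
  gact n (tvertex v m : talented_monoid) = tvertex v (m + n).
Proof. by rewrite [LHS]talented_act_pi mshift1. Qed.

Lemma talented_pi_sum (I : Type) (r : seq I) (F : I -> {mset tgen}) :
  \pi_talented (\sum_(i <- r) F i) = \sum_(i <- r) \pi_talented (F i).
Proof.
elim: r => [|i r IHr]; first by rewrite !big_nil.
by rewrite !big_cons -IHr; exact/esym/talented_add_pi.
Qed.

Lemma tvertexE (v : obj L) (n : 'Z^k) (i : 'I_k) :
  finite_set (paths_from v (egen i)) -> paths_from v (egen i) !=set0 ->
  tvertex v n =
    \sum_(a <- fset_set (paths_from v (egen i)))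
       tvertex (src a) (n + zvec (egen i)).
Proof.
move=> _ vi; rewrite -talented_pi_sum; apply/talented_piP.
rewrite -(finite_support_mset1 _ (fun a => (src a, n + zvec (egen i)))).
exact: tcongr_gen.
Qed.

End TalentedMonoid.

(* Main.v *)
Require Import Defs.
From mathcomp Require Import all_boot all_order all_algebra.
From mathcomp Require Import finmap multiset.
From mathcomp Require Import boolp classical_sets cardinality fsbigop.
Import Defs.

(** The link between the two sides is the notion of a hereditary and saturated
set of vertices.

If [H] is such a set, the multisets of generators [v(n)] with all [v] in [H]
form a union of classes of the congruence defining the talented monoid
([supported_tcongr]), and their classes form an order ideal ([order_ideal_of]).
Taking for [H] the empty set, which is saturated because there are no sources,
shows that only the empty multiset represents [0]; hence the monoid is conical,
and no generator vanishes.  Conversely, the vertices [v] such that [v(0)] lies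
in a given order ideal form a hereditary and saturated set.  Thus a proper
nonzero order ideal exists exactly when a proper nonempty hereditary and
saturated set does.

If [x] is an infinite path, the vertices from which no path leads to a vertex
of [x] form a hereditary and saturated set ([not_reaching_saturated]) which
misses [x(0)]; when the monoid is simple this set is empty, which is
cofinality.

Conversely, let [H] be hereditary and saturated and [v] a vertex outside [H].
By saturation every vertex outside [H] emits a path of degree [(1, ..., 1)]
whose source is again outside [H].  Concatenating such paths, and cutting the
finite products at all intermediate degrees by unique factorization, yields an
infinite path all of whose vertices are outside [H]
([infinite_path_avoiding]).  If moreover [L] is cofinal, every vertex [w]
reaches some vertex of this path, so [w] is not in [H] either: [H] is empty. *)

Set Implicit Arguments.
Unset Strict Implicit.
Unset Printing Implicit Defensive.

Import GRing.Theory.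
Local Open Scope mset_scope.
Local Open Scope classical_set_scope.
Local Open Scope ring_scope.
Local Open Scope quotient_scope.

(** * Unique factorization and segments of a morphism *)

Section Segments.
Variables (k : nat) (L : kgraph k).
Implicit Types (a b c d l : mor L) (p q r : 'N^k).

Lemma addNI p q r : p + q = p + r -> q = r.
Proof.
move=> /ffunP e; apply/ffunP => i; move: (e i); rewrite !ffunE.
exact: addnI.
Qed.

Lemma comp_inj a b c d : src a = rng b -> src c = rng d ->
  comp a b = comp c d -> deg a = deg c -> a = c /\ b = d.
Proof.
move=> ab cd e dac.
have dbd : deg b = deg d.
  by apply: (@addNI (deg a)); rewrite {2}dac -!deg_comp// e.
have [w [_ u]] := unique_factorization (deg_comp ab).
have E1 := u (a, b) (And4 ab erefl erefl erefl).
have E2 := u (c, d) (And4 cd e (esym dac) (esym dbd)).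
by move: E1; rewrite E2 => -[-> ->].
Qed.

(** Morphisms of degree [0] are identities, because both [a id] and [id a]
factor [a] into two morphisms of degree [0]. *)
Lemma deg_eq0 a : deg a = 0 -> a = idm (rng a).
Proof.
move=> a0.
have [] // := @comp_inj a (idm (src a)) (idm (rng a)) a.
- by rewrite rng_id.
- by rewrite src_id.
- by rewrite comp_idl comp_idr.
- by rewrite deg_id.
Qed.

Lemma factorization l p q : deg l = p + q ->
  exists a b, [/\ src a = rng b, l = comp a b, deg a = p & deg b = q].
Proof. by move=> /unique_factorization [[a b] [ab _]]; exists a, b. Qed.

Lemma lev_subnK p q : lev p q -> q = p + [ffun i => (q i - p i)%N].
Proof.
move=> /forallP pq; apply/ffunP => i; rewrite !ffunE.
by rewrite natrDE subnKC.
Qed.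

(** Induction on degrees, adding one generator at a time. *)
Lemma degree_ind (P : 'N^k -> Prop) :
  P 0 -> (forall (i : 'I_k) n, P n -> P (egen i + n)) -> forall n, P n.
Proof.
move=> P0 PS n; move sn : (\sum_i n i)%N => s.
elim: s n sn => [|s IHs] n sn.
  suff -> : n = 0 by [].
  apply/ffunP => i; rewrite ffunE; apply/eqP.
  by move/eqP: sn; rewrite sum_nat_eq0 => /forallP/(_ i).
have [i ni] : exists i, (0 < n i)%N.
  apply/existsP; apply: contra_eqT sn; rewrite negb_exists => /forallP h.
  by rewrite big1// => i _; apply/eqP; move: (h i); rewrite lt0n negbK.
have nE : n = egen i + [ffun j => (n j - egen i j)%N].
  by apply: lev_subnK; apply/forallP => j; rewrite ffunE; case: eqP => // ->.
have ei : (\sum_j egen i j = 1)%N.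
  rewrite (bigD1 i)//= ffunE eqxx big1 // => j ji.
  by rewrite ffunE (negbTE ji).
rewrite nE; apply/PS/IHs/succn_inj; rewrite -sn -add1n -ei -big_split /=.
by apply: eq_bigr => j _; rewrite [in RHS]nE [RHS]ffunE natrDE.
Qed.

(** [segment l p q m] says that [m] is what remains of [l] after removing the
initial part of degree [p] and all that comes after degree [q]. *)
Definition segment l p q (m : mor L) :=
  exists a b, [/\ src a = rng m, src m = rng b, l = comp a (comp m b),
    deg a = p & q = p + deg m].

Lemma segment_exists l p q : lev p q -> lev q (deg l) ->
  exists m, segment l p q m.
Proof.
move=> /lev_subnK pq /lev_subnK; rewrite {1}pq -addrA.
move=> /factorization [a [c [ac -> da dc]]].
have [m [b [mb ec dm _]]] := factorization dc.
exists m, a, b; split=> //; last by rewrite dm.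
- by rewrite ac ec rng_comp.
- by rewrite ec.
Qed.

Lemma segment_comp l p q r m n : segment l p q m -> segment l q r n ->
  src m = rng n /\ segment l p r (comp m n).
Proof.
move=> [a [b [am mb -> da qe]]] [c [d [cn nd e dc re]]].
have amb : src a = rng (comp m b) by rewrite rng_comp.
have [E1 E2] : comp a m = c /\ b = comp n d.
  apply: comp_inj.
  - by rewrite src_comp.
  - by rewrite rng_comp.
  - by rewrite -compA.
  - by rewrite deg_comp// da -qe.
have mn : src m = rng n by rewrite -cn -E1 src_comp.
split=> //; exists a, d; split => //.
- by rewrite rng_comp.
- by rewrite src_comp.
- by rewrite E2 -compA.
- by rewrite deg_comp// addrA -qe.
Qed.

Lemma segment_uniq l p q m n : segment l p q m -> segment l p q n -> m = n.
Proof.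
move=> [a [b [am mb -> da qe]]] [c [d [cn nd e dc re]]].
have [_ E] : a = c /\ comp m b = comp n d.
  by apply: comp_inj; rewrite ?rng_comp// da dc.
have [] // := comp_inj mb nd E.
by apply: (@addNI p); rewrite -qe.
Qed.

Lemma segment_extend l c p q m : src l = rng c -> segment l p q m ->
  segment (comp l c) p q m.
Proof.
move=> lc [a [b [am mb e da qe]]].
have amb : src a = rng (comp m b) by rewrite rng_comp.
have bc : src b = rng c by rewrite -lc e !src_comp.
exists a, (comp b c); split => //; first by rewrite rng_comp.
rewrite e -compA//; last by rewrite src_comp.
by congr (comp a _); rewrite compA.
Qed.

End Segments.

(** * Infinite paths from iterated concatenation *)

Section Concatenation.
Variables (k : nat) (L : kgraph k).
Variables (step : obj L -> mor L).
Hypothesis rng_step : forall v, rng (step v) = v.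
Hypothesis deg_step : forall v, deg (step v) = [ffun=> 1%N].
Variable v : obj L.

(** The concatenation of the first [n] steps of the walk which starts at [v]
and follows [step] at each vertex. *)
Fixpoint prefix (n : nat) : mor L :=
  if n is n'.+1 then comp (prefix n') (step (src (prefix n'))) else idm v.

Lemma deg_prefix n : deg (prefix n) = [ffun=> n].
Proof.
elim: n => [|n IHn] /=.
  by rewrite deg_id; apply/ffunP => i; rewrite !ffunE.
rewrite deg_comp ?rng_step// IHn deg_step; apply/ffunP => i; rewrite !ffunE.
by rewrite natrDE addn1.
Qed.

Lemma segment_prefix_le n n' p q m : (n <= n')%N ->
  segment (prefix n) p q m -> segment (prefix n') p q m.
Proof.
move=> /subnK <-; elim: (n' - n)%N => [|j IHj]; first by rewrite add0n.
by move=> /IHj; rewrite addSn /=; apply: segment_extend; rewrite rng_step.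
Qed.

Lemma segment_prefix_exists (p q : 'N^k) : lev p q ->
  exists m n, segment (prefix n) p q m.
Proof.
move=> pq; pose n := (\max_i q i)%N.
have qn : lev q (deg (prefix n)).
  by rewrite deg_prefix; apply/forallP => i; rewrite ffunE leq_bigmax.
by have [m ?] := segment_exists pq qn; exists m, n.
Qed.

(** The segment from [p] to [q] of the infinite concatenation of the steps; it
is read off any sufficiently long prefix.  The value for [p] not below [q] is
irrelevant. *)
Definition concat_mor (p q : 'N^k) : mor L :=
  xget (idm v) [set m | exists n, segment (prefix n) p q m].

Lemma concat_morP (p q : 'N^k) : lev p q ->
  exists n, segment (prefix n) p q (concat_mor p q).
Proof.
move=> /segment_prefix_exists[m hm].
rewrite /concat_mor; case: xgetP => [_ _ //|none].
by case: (none m).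
Qed.

(** The segment does not depend on the prefix it is read off. *)
Lemma concat_mor_eq (p q : 'N^k) n m : lev p q ->
  segment (prefix n) p q m -> concat_mor p q = m.
Proof.
move=> /concat_morP[n' s'] s.
apply: (@segment_uniq _ _ (prefix (maxn n n')) p q).
- exact: segment_prefix_le (leq_maxr n n') s'.
- exact: segment_prefix_le (leq_maxl n n') s.
Qed.

Lemma concat_mor_comp (p q r : 'N^k) : lev p q -> lev q r ->
  src (concat_mor p q) = rng (concat_mor q r) /\
  concat_mor p r = comp (concat_mor p q) (concat_mor q r).
Proof.
move=> pq qr; have [n s] := concat_morP pq; have [n' s'] := concat_morP qr.
have t := segment_prefix_le (leq_maxl n n') s.
have t' := segment_prefix_le (leq_maxr n n') s'.
have [e u] := segment_comp t t'.
by split=> //; exact: concat_mor_eq (lev_trans pq qr) u.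
Qed.

Lemma deg_concat_mor (p q : 'N^k) : lev p q ->
  deg (concat_mor p q) = [ffun i => (q i - p i)%N].
Proof.
move=> pq; have [n [a [b [_ _ _ _ e]]]] := concat_morP pq.
by apply: (@addNI _ p); rewrite -e; exact: lev_subnK.
Qed.

(** The vertex at position [p] of the infinite concatenation. *)
Definition concat_obj (p : 'N^k) : obj L := rng (concat_mor p p).

Lemma concat_mor_id p : concat_mor p p = idm (concat_obj p).
Proof.
apply: deg_eq0; rewrite deg_concat_mor ?lev_refl//.
by apply/ffunP => i; rewrite !ffunE subnn.
Qed.

Lemma rng_concat_mor (p q : 'N^k) : lev p q ->
  rng (concat_mor p q) = concat_obj p.
Proof.
move=> pq; have [<- _] := concat_mor_comp (lev_refl p) pq.
by rewrite concat_mor_id src_id.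
Qed.

Lemma src_concat_mor (p q : 'N^k) : lev p q ->
  src (concat_mor p q) = concat_obj q.
Proof. by move=> pq; have [-> _] := concat_mor_comp pq (lev_refl q). Qed.

Lemma concat_fcomp (a b : mor (Omega k)) : src a = rng b ->
  concat_mor (val (comp a b)).1 (val (comp a b)).2 =
  comp (concat_mor (val a).1 (val a).2) (concat_mor (val b).1 (val b).2).
Proof.
move=> ab; rewrite (val_omega_comp ab) /=.
have e : (val b).1 = (val a).2 by [].
have lb : lev (val a).2 (val b).2 by rewrite -e; exact: (valP b).
by rewrite e; have [_ ->] := concat_mor_comp (valP a) lb.
Qed.

(** The infinite concatenation of the steps, as an infinite path. *)
Definition concat_path : infinite_path L :=
  @KFunctor k (Omega k) L concat_obj
    (fun a : omega_mor k => concat_mor (val a).1 (val a).2)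
    (fun a => rng_concat_mor (valP a)) (fun a => src_concat_mor (valP a))
    concat_mor_id concat_fcomp (fun a => deg_concat_mor (valP a)).

End Concatenation.

(** * Hereditary and saturated sets of vertices *)

Section Hereditary.
Variables (k : nat) (L : kgraph k).
Implicit Types (H : set (obj L)).

(** A set of vertices is hereditary when it is closed under passing from the
range of a path to its source. *)
Definition hereditary H := forall a : mor L, H (rng a) -> H (src a).

(** A set of vertices is saturated when it contains every vertex all of whose
edges of some given colour have their source in the set. *)
Definition saturated H := forall (v : obj L) (i : 'I_k),
  (forall a, paths_from v (egen i) a -> H (src a)) -> H v.

(** A set is hereditary as soon as it is closed under passing to the sources of
edges, since every path is a composition of edges. *)
Lemma hereditary_edges H :
  (forall (v : obj L) (i : 'I_k) a, H v -> paths_from v (egen i) a ->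
    H (src a)) ->
  hereditary H.
Proof.
move=> edge a; move da : (deg a) => n.
elim/degree_ind: n a da => [|i n IHn] a da.
  by rewrite {2}(deg_eq0 da) src_id.
have [b [c [bc -> db dc]]] := factorization da.
rewrite rng_comp// src_comp// => Hb; apply: IHn => //.
by rewrite -bc; exact: (edge (rng b) i).
Qed.

Lemma saturated_path_avoiding H (v : obj L) (n : 'N^k) : saturated H -> ~ H v ->
  exists2 a, paths_from v n a & ~ H (src a).
Proof.
move=> satH; elim/degree_ind: n v => [|i n IHn] v Hv.
  exists (idm v); last by rewrite src_id.
  by split; [exact: rng_id|exact: deg_id].
have [a [ra da] Ha] : exists2 a, paths_from v (egen i) a & ~ H (src a).
  have [//|h] := pselect (exists2 a, paths_from v (egen i) a & ~ H (src a)).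
  case: Hv; apply: (satH v i) => a va; have [//|Ha] := pselect (H (src a)).
  by case: h; exists a.
have [b [rb db] Hb] := IHn _ Ha.
have ab : src a = rng b by [].
exists (comp a b); last by rewrite src_comp.
by split; [rewrite rng_comp|rewrite deg_comp// da db].
Qed.

(** The concatenated steps avoid [H] at the positions [(n, ..., n)]; as [H] is
hereditary, the path avoids it at every earlier position too. *)
Lemma infinite_path_avoiding H (v : obj L) : no_sources L -> hereditary H ->
  saturated H -> ~ H v -> exists x : infinite_path L, forall n, ~ H (fobj x n).
Proof.
move=> hns herH satH Hv.
have /choice[step stepP] (w : obj L) : exists a,
    paths_from w [ffun=> 1%N] a /\ (~ H w -> ~ H (src a)).
  have [Hw|Hw] := pselect (H w).
    by have [a wa] := hns w [ffun=> 1%N]; exists a.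
  by have [a wa Ha] := saturated_path_avoiding [ffun=> 1%N] satH Hw; exists a.
have rng_step w : rng (step w) = w by have [[]] := stepP w.
have deg_step w : deg (step w) = [ffun=> 1%N] by have [[]] := stepP w.
have avoid n : ~ H (src (prefix step v n)).
  elim: n => [|n IHn] /=; first by rewrite src_id.
  rewrite src_comp ?rng_step//.
  by have [_] := stepP (src (prefix step v n)); apply.
exists (concat_path rng_step deg_step v) => p Hp.
have [n [a [b [am mb e _ _]]]] := concat_morP rng_step deg_step v (lev_refl p).
apply: (avoid n); rewrite e src_comp ?rng_comp//.
by apply: herH; rewrite rng_comp.
Qed.

Section NotReaching.
Variable x : infinite_path L.

(** The vertices from which no path leads to a vertex of [x]. *)
Definition not_reaching : set (obj L) :=
  [set w | forall n, ~ (paths_between w (fobj x n) !=set0)].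

Lemma not_reaching_hereditary : hereditary not_reaching.
Proof.
move=> a Ha n [b [rb sb]]; apply: (Ha n); exists (comp a b).
have ab : src a = rng b by [].
by split; rewrite ?rng_comp ?src_comp.
Qed.

Lemma not_reaching_saturated : saturated not_reaching.
Proof.
move=> w i Hw n [b [rb sb]].
(* Prolonging the path along [x] makes its degree at least [e_i], so that its
   first edge of colour [i] can be split off. *)
pose n' := n + egen i.
have nn' : lev n n'.
  by apply/forallP => j; rewrite ffunE natrDE leq_addr.
pose c := fmor x (exist (fun p => lev p.1 p.2) (n, n') nn' : mor (Omega k)).
have rc : rng c = fobj x n by rewrite fmor_rng.
have sc : src c = fobj x n' by rewrite fmor_src.
have dc : deg c = egen i.
  by rewrite fmor_deg; apply/ffunP => j; rewrite !ffunE /= natrDE addKn.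
have bc : src b = rng c by rewrite rc.
have : deg (comp b c) = egen i + deg b by rewrite deg_comp// dc addrC.
move=> /factorization[a [d [ad e da _]]].
have wa : paths_from w (egen i) a.
  by split=> //; rewrite -rb -(rng_comp bc) e rng_comp.
apply: (Hw a wa n'); exists d; split => //.
by rewrite -(src_comp ad) -e src_comp.
Qed.

Lemma not_reaching_path n : ~ not_reaching (fobj x n).
Proof.
by move=> /(_ n); apply; exists (idm (fobj x n)); split; rewrite ?rng_id ?src_id.
Qed.

End NotReaching.

End Hereditary.

(** * Order ideals of the talented monoid *)

Section Ideals.
Variables (k : nat) (L : kgraph k).
Hypothesis hrf : row_finite L.
Hypothesis hns : no_sources L.
Implicit Types (H : set (obj L)) (x y : {mset tgen L}).

Local Notation M := (talented_monoid L).

(** The multiset [x] of generators [v(n)] only involves vertices [v] in [H]. *)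
Definition supported H x := forall g : tgen L, g \in x -> H g.1.

Lemma supported0 H : supported H 0.
Proof. by move=> g; rewrite in_mset0. Qed.

Lemma supportedD H x y : supported H (x + y) <-> supported H x /\ supported H y.
Proof.
split=> [xy|[hx hy] g].
  by split=> g hg; apply: xy; rewrite in_msetD hg ?orbT.
by rewrite in_msetD => /orP[/hx|/hy].
Qed.

Lemma supported1 H (g : tgen L) : supported H [mset g] <-> H g.1.
Proof.
split=> [|Hg g']; first by apply; rewrite in_mset1.
by rewrite in_mset1 => /eqP ->.
Qed.

Lemma supported_sum H (I : eqType) (r : seq I) (F : I -> {mset tgen L}) :
  supported H (\sum_(i <- r) F i) <-> (forall i, i \in r -> supported H (F i)).
Proof.
elim: r => [|j r IHr].
  by rewrite big_nil; split=> // _; exact: supported0.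
rewrite big_cons supportedD IHr; split=> [[hj hr] i|h].
  by rewrite inE => /orP[/eqP ->|/hr].
by split=> [|i ir]; apply: h; rewrite inE ?eqxx// ir orbT.
Qed.

Lemma mset_sum1 x : x = \sum_(g <- x) [mset g].
Proof.
rewrite -[LHS]mshift_id; apply: eq_bigr => -[v n] _.
by rewrite /= addr0.
Qed.

Lemma supported_mshift H (n : 'Z^k) x :
  supported H x -> supported H (mshift n x).
Proof.
move=> hx; apply/supported_sum => g gx; apply/supported1 => /=.
exact: hx gx.
Qed.

Lemma supported_set0 x : supported set0 x -> x = 0.
Proof.
move=> hx; apply/msetP => g; rewrite mset0E; apply/eqP.
by rewrite mset_eq0; apply/negP => /hx.
Qed.

Lemma supported_tcongr H x y : hereditary H -> saturated H ->
  tcongr x y -> (supported H x <-> supported H y).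
Proof.
move=> herH satH; elim=> {x y} [v n i _|x|x y _ ->|y x z _ -> _ ->|x y z _ xy] //.
- rewrite finite_support_mset1 supported1 supported_sum /=.
  have in_edges a : (a \in fset_set (paths_from v (egen i))) <->
      paths_from v (egen i) a.
    by rewrite in_fset_set// in_setE.
  split=> [Hv a /in_edges[ra _]|h].
    by apply/supported1; apply: herH; rewrite ra.
  by apply: (satH v i) => a /in_edges/h/supported1.
- by rewrite !supportedD xy.
Qed.

Lemma hereditary_set0 : hereditary (set0 : set (obj L)).
Proof. by []. Qed.

Lemma saturated_set0 : saturated (set0 : set (obj L)).
Proof. by move=> v i h; have [a /h] := hns v (egen i). Qed.

(** The elements of the talented monoid represented by multisets supported in
[H].  Only a chosen representative is tested; by [supported_tcongr] the choice
is immaterial when [H] is hereditary and saturated. *)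
Definition ideal_of H : set M :=
  [set t : M | supported H (repr (t : talented L))].

Lemma ideal_of_pi H x : hereditary H -> saturated H ->
  ideal_of H (\pi_(talented L) x) <-> supported H x.
Proof.
by move=> herH satH; exact: supported_tcongr herH satH (tcongr_reprl x).
Qed.

Lemma talented_piD x y :
  \pi_(talented L) x + \pi_(talented L) y = \pi_(talented L) (x + y).
Proof. exact: talented_add_pi. Qed.

Lemma order_ideal_of H : hereditary H -> saturated H ->
  order_ideal (ideal_of H).
Proof.
move=> herH satH; split.
- by apply/(ideal_of_pi _ herH satH); exact: supported0.
- elim/quotW=> x; elim/quotW=> y.
  rewrite talented_piD !ideal_of_pi// => hx hy; exact/supportedD.
- move=> n; elim/quotW=> x; rewrite [gact _ _]talented_act_pi !ideal_of_pi//.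
  exact: supported_mshift.
- elim/quotW=> x y [z ->]; elim/quotW: z => z.
  by rewrite talented_piD !ideal_of_pi// => /supportedD[].
Qed.

Lemma ideal_of_tvertex H v n : hereditary H -> saturated H ->
  ideal_of H (tvertex v n) <-> H v.
Proof. by move=> herH satH; rewrite ideal_of_pi// supported1. Qed.

(** No nonempty multiset represents [0]. *)
Lemma talented_pi_eq0 x : \pi_(talented L) x = 0 -> x = 0.
Proof.
move=> /talented_piP/(supported_tcongr hereditary_set0 saturated_set0) e.
by apply: supported_set0; apply/e; exact: supported0.
Qed.

Lemma tvertex_neq0 (v : obj L) n : tvertex v n <> 0.
Proof. by move=> /talented_pi_eq0/mset1_neq0. Qed.

Lemma talented_conical : conical M.
Proof.
elim/quotW=> x; elim/quotW=> y; rewrite talented_piD => /talented_pi_eq0 e.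
have /supportedD[hx hy] : supported set0 (x + y).
  by rewrite e; exact: supported0.
by rewrite (supported_set0 hx) (supported_set0 hy).
Qed.

Section VerticesOf.
Variable J : set M.
Hypothesis idJ : order_ideal J.

(** The vertices [v] with [v(0)] in [J]; any other degree gives the same set,
by invariance under the action. *)
Definition vertices_of : set (obj L) := [set v | J (tvertex v 0)].

Lemma vertices_ofP (v : obj L) (n : 'Z^k) : J (tvertex v n) <-> vertices_of v.
Proof.
split=> h.
  have := ideal_act idJ (- n) h.
  by rewrite talented_act_tvertex subrr.
have := ideal_act idJ n h.
by rewrite talented_act_tvertex add0r.
Qed.

(** An order ideal contains a sum if and only if it contains all its terms. *)
Lemma ideal_sum (I : eqType) (r : seq I) (F : I -> M) :
  J (\sum_(i <- r) F i) <-> (forall i, i \in r -> J (F i)).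
Proof.
elim: r => [|j r IHr].
  by rewrite big_nil; split=> // _; exact: ideal_zero idJ.
rewrite big_cons; split=> [h i|h]; last first.
  apply: (ideal_add idJ); first by apply: h; rewrite inE eqxx.
  by apply/IHr => i ir; apply: h; rewrite inE ir orbT.
rewrite inE => /orP[/eqP ->|ir].
  by apply: (ideal_le idJ) h; exists (\sum_(i <- r) F i).
move: i ir; apply/IHr; apply: (ideal_le idJ) h; exists (F j).
by rewrite addrC.
Qed.

Lemma ideal_pi x : J (\pi_(talented L) x) <-> supported vertices_of x.
Proof.
rewrite {1}[x]mset_sum1 talented_pi_sum ideal_sum.
by split=> h [v n] gx; apply/(vertices_ofP v n); exact: h gx.
Qed.

(** The defining relation of the talented monoid, read off in [J]. *)
Lemma vertices_of_edges (v : obj L) (i : 'I_k) : vertices_of v <->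
  (forall a, paths_from v (egen i) a -> vertices_of (src a)).
Proof.
rewrite -(vertices_ofP v 0) (tvertexE 0 (hrf v (egen i)) (hns v (egen i))).
rewrite ideal_sum; split=> h a va.
  apply/(vertices_ofP _ (0 + zvec (egen i))); apply: h.
  by rewrite in_fset_set//; exact/mem_set.
by apply/vertices_ofP; apply: h; move: va; rewrite in_fset_set// => /set_mem.
Qed.

Lemma vertices_of_saturated : saturated vertices_of.
Proof. by move=> v i h; apply/(vertices_of_edges v i). Qed.

Lemma vertices_of_hereditary : hereditary vertices_of.
Proof.
by apply: hereditary_edges => v i a /(vertices_of_edges v i) + va; apply.
Qed.

End VerticesOf.

Lemma cofinal_ideal (J : set M) : cofinal L -> order_ideal J ->
  J = [set 0] \/ J = setT.
Proof.
move=> cofL idJ.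
have [[v Hv]|H0] := pselect (exists v, vertices_of J v); [right|left].
  have HT w : vertices_of J w.
    have [//|Hw] := pselect (vertices_of J w).
    have [x xH] := infinite_path_avoiding hns (vertices_of_hereditary idJ)
      (vertices_of_saturated idJ) Hw.
    have [n [a [ra sa]]] := cofL x v; case: (xH n); rewrite -sa.
    by apply: vertices_of_hereditary; rewrite ?ra.
  by apply/seteqP; split=> //; elim/quotW=> x _; apply/(ideal_pi idJ) => g _.
apply/seteqP; split=> [|_ ->]; last exact: ideal_zero idJ.
elim/quotW=> x /(ideal_pi idJ) hx; suff -> : x = 0 by [].
by apply: supported_set0 => g /hx gJ; apply: H0; exists g.1.
Qed.

Lemma simple_cofinal : simple_gmonoid M -> cofinal L.
Proof.
move=> [_ _ simple] x v.
have her := @not_reaching_hereditary _ _ x.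
have sat := @not_reaching_saturated _ _ x.
have [J0|JT] := simple _ (order_ideal_of her sat).
  have : ~ not_reaching x v.
    by move=> /(ideal_of_tvertex v 0 her sat); rewrite J0; exact: tvertex_neq0.
  by move=> /existsNP[n /contrapT ?]; exists n.
case: (@not_reaching_path _ _ x 0).
by apply/(ideal_of_tvertex _ 0 her sat); rewrite JT.
Qed.

End Ideals.

Theorem proposition4p8 (k : nat) (hk : (0 < k)%N) (L : kgraph k)
    (hrf : row_finite L) (hns : no_sources L) :
  cofinal L <-> simple_gmonoid (talented_monoid L).
Proof.
split=> [cofL|]; last exact: simple_cofinal.
split; [|exact: talented_conical|by move=> J; exact: cofinal_ideal].
by have [v] := obj_inh L; exists (tvertex v 0); apply/eqP; exact: tvertex_neq0.
Qed.
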